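(* Let $G$ be a finite group such that $|\tau_e(G)|=3$ and such that $G$ is not a $2$-group with $c_2>1$ (i.e. $G$ is not a $2$-group having more than one cyclic subgroup of order $2$). Then $\tau_e(G)$ is an arithmetic progression if and only if $G\cong S_3$.
   Context: For a finite group $G$, let $o(x)$ denote the order of $x\in G$, and define the equivalence relation $x\sim y \iff o(x)=o(y)$ on $G$. The same-order type $\tau_e(G)$ is the set of the sizes of the equivalence classes of $\sim$; that is, $\tau_e(G)$ is the set of positive integers of the form $|\{x\in G : o(x)=n\}|$, where $n$ runs over the orders of elements of $G$. It is a set, so equal sizes are counted once. A finite set of integers is called an arithmetic progression if its elements, listed in increasing order, form an arithmetic progression, i.e. consecutive elements differ by a constant $r$ (the ratio). The number of cyclic subgroups of order $2$ of $G$ is denoted by $c_2$. $S_3$ is the symmetric group on three letters. *)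

(* Defs.v *)
From mathcomp Require Import all_boot all_fingroup all_solvable.
From mathcomp Require Import finmap.

Set Implicit Arguments.
Unset Strict Implicit.
Unset Printing Implicit Defensive.

Definition same_order (gT : finGroupType) : rel gT :=
  fun x y => #[x]%g == #[y]%g.

(* [tau_e G] is a finite set: classes of equal size contribute one element. *)
Definition tau_e (gT : finGroupType) (G : {group gT}) : {fset nat} :=
  [fset #|C| | C : {set gT} in equivalence_partition (@same_order gT) G]%fset.

(* [sorted] tests a relation on consecutive items only. The ratio can be taken
   in [nat] because the elements are listed in increasing order. *)
Definition arithmetic_progression (A : {fset nat}) : Prop :=
  exists r : nat, sorted (fun m n => n == m + r) (sort leq (enum_fset A)).

Definition num_cyclic_subgroups (gT : finGroupType) (n : nat)
    (G : {group gT}) : nat :=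
  #|[set H in subgroups G | cyclic H & #|H| == n]|.

(* Main.v *)
Require Import Defs.
From mathcomp Require Import all_boot all_fingroup all_solvable.
From mathcomp Require Import finmap.
From mathcomp Require Import zify.

(** Write [N n] for the number of elements of order [n], so that [tau_e G] is
    the set of the nonzero [N n], among them [N 1 = 1].  Inversion pairs off the
    elements of order [n > 2], so [N n] is even for those [n]
    ([num_order_even]).  A three-term progression starting at [1] is
    [{1, a, 2a - 1}]; its largest term is odd and exceeds [1], so it can only be
    [N 2], and then every order [n > 2] that occurs has [N n = a], an even
    number.

    Everything else comes from Frobenius' theorem that [d] divides the number of
    solutions of [x ^ d = 1] whenever [d] divides [#|G|]
    ([dvdn_sum_num_order]).  Since [N 2 > 1], the hypothesis on [2]-groups
    provides an odd prime [p] dividing [#|G|].  Taking [d = p] gives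
    [p | a + 1], and [d = 2p] gives [p | 3a] or [p | 4a]; as [p] is prime to
    [a], this leaves [p = 3] and no element of order [6] ([odd_prime_eq3]).
    Taking [d = 9] and [d = 12] excludes the orders [9] and [4].  Hence all
    orders are at most [3] and [#|G| = 1 + (2a - 1) + a = 3a]
    ([card_orders_le3]).

    A Sylow [2]-subgroup [P] now has order [a], is elementary abelian, and is
    the centraliser of each of its nontrivial elements because an element of
    order [3] commuting with an involution would give one of order [6]
    ([cent1_Sylow2]).  Distinct Sylow [2]-subgroups therefore meet trivially,
    and there are at least two of them because [P] has too few elements to
    contain the [2a - 1] involutions; so [a * a <= 3a] ([Sylow2_le3]).  As [a] is
    [2] modulo [3], it equals [2], and [G] has order [6] and three involutions.
    Such a group is dihedral, and so is the symmetric group.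

    Conversely, if [#|G| = 6], the three distinct class sizes include [1] and add
    up to at most [6], so they are [1], [2] and [3]. *)

(** * Counting elements by their order *)

Section OrderCounts.

Set Implicit Arguments.
Unset Strict Implicit.
Unset Printing Implicit Defensive.

Local Open Scope group_scope.
Local Open Scope nat_scope.

Variable gT : finGroupType.
Implicit Types (G P : {group gT}) (x y : gT) (s : seq nat).

Definition num_order G n := #|[set x in G | #[x] == n]|.

Lemma num_order_gt0P G n :
  reflect (exists2 x, x \in G & #[x] = n) (0 < num_order G n).
Proof.
apply: (iffP card_gt0P) => [[x]|[x Gx ox]].
  by rewrite inE => /andP[Gx /eqP ox]; exists x.
by exists x; rewrite inE Gx ox eqxx.
Qed.

Lemma num_order1 G : num_order G 1 = 1.
Proof.
rewrite /num_order -[RHS](cards1 (1%g : gT)); apply: eq_card => x.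
by rewrite !inE order_eq1 andbC; case: eqP => // ->; rewrite group1.
Qed.

Lemma sum_num_order G s : uniq s ->
  #|[set x in G | #[x] \in s]| = \sum_(n <- s) num_order G n.
Proof.
elim: s => [_|n s IHs /= /andP[ns us]].
  by rewrite big_nil; apply: eq_card0 => x; rewrite !inE andbF.
rewrite big_cons -IHs // /num_order -cardsUI.
rewrite [X in _ + X]eq_card0 ?addn0 => [|x].
  by apply: eq_card => x; rewrite !inE -andb_orr.
rewrite !inE; apply/negP => /andP[/andP[_ /eqP->] /andP[_]]; exact/negP.
Qed.

(** Frobenius' theorem, with the solutions of [x ^ d = 1] sorted by their order:
    an order contributes exactly when it divides [d]. *)
Lemma dvdn_sum_num_order G d s : uniq s -> s =i [pred m | m %| d] ->
  d %| #|G| -> d %| \sum_(n <- s) num_order G n.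
Proof.
move=> us sE /Frobenius_Ldiv; rewrite -sum_num_order //.
by congr (_ %| _); apply: eq_card => x; rewrite !inE sE inE order_dvdn.
Qed.

(** An element of order above [2] differs from its inverse, so the orbits of
    inversion on the elements of order [n] all have two elements. *)
Lemma num_order_even G n : 2 < n -> ~~ odd (num_order G n).
Proof.
move=> n2; rewrite /num_order.
set A := [set x in G | _].
rewrite -(@fcard_order_set _ (@invg gT) invg_inj 2 (mem A));
  rewrite ?muln2 ?odd_double //.
  apply/subsetP => x; rewrite inE => /andP[_ /eqP ox].
  rewrite inE; apply/eqP.
  apply: (@order_cycle _ _ [:: x; x^-1]); rewrite ?mem_head //.
    by rewrite /= invgK !eqxx.
  rewrite /= inE andbT; apply/negP => /eqP xV.
  have: #[x] %| 2 by rewrite order_dvdn expgS expg1 {1}xV mulVg.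
  by rewrite ox => /dvdn_leq; lia.
by move=> x _ /eqP <-; rewrite !inE groupV orderV.
Qed.

(** The class of [x] is the set of elements of order [#[x]], so membership in
    [tau_e G] becomes a statement about [num_order], free of partitions. *)
Lemma mem_tau_e G n :
  reflect (exists2 x, x \in G & n = num_order G #[x]) (n \in tau_e G).
Proof.
have eqR : {in G & &, equivalence_rel (@same_order gT)}.
  by move=> x y z _ _ _; split=> [|/eqP e]; rewrite /same_order ?eqxx ?e.
have PG := equivalence_partitionP eqR.
set E := equivalence_partition _ _ in PG.
have [/eqP covE trivE E0] := and3P PG.
have cardE x : x \in G -> #|pblock E x| = num_order G #[x].
  move=> Gx; apply: eq_card => y; rewrite inE.
  have [Gy|nGy] := boolP (y \in G).
    by rewrite pblock_equivalence_partition // /same_order eq_sym.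
  apply: contraNF nGy => yB; rewrite -covE; apply/bigcupP.
  by exists (pblock E x); rewrite // pblock_mem // covE.
apply: (iffP (imfsetP _ _ _ _)) => [[C /= CP ->]|[x Gx ->]]; last first.
  by exists (pblock E x); rewrite /= ?cardE // pblock_mem // covE.
have [|x Cx] := set0Pn C _; first by apply: contraNneq E0 => <-.
have Gx : x \in G by rewrite -covE; apply/bigcupP; exists C.
by exists x => //; rewrite -cardE // (def_pblock trivE CP Cx).
Qed.

Lemma num_order_dvd_gt0 G m n : 0 < num_order G n -> m %| n ->
  0 < num_order G m.
Proof.
move=> /num_order_gt0P[x Gx ox] mn; apply/num_order_gt0P.
have n0 : 0 < n by rewrite -ox order_gt0.
have m0 := dvdn_gt0 n0 mn.
exists (x ^+ (n %/ m)); first exact: groupX.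
by rewrite orderXdiv ox ?divn_dvd ?dvdn_div // divnA // mulKn.
Qed.

Lemma num_order_gt0_dvd G n : 0 < num_order G n -> n %| #|G|.
Proof. by move=> /num_order_gt0P[x Gx <-]; apply: order_dvdG. Qed.

Lemma num_order_prime_gt0 G p : prime p -> p %| #|G| -> 0 < num_order G p.
Proof. by move=> pp /(Cauchy pp)[x Gx ox]; apply/num_order_gt0P; exists x. Qed.

(** * Groups with [2a - 1] involutions and [a] elements of each larger order *)

Section ConstantCounts.

Variables (G : {group gT}) (a : nat).
Hypothesis a_gt1 : 1 < a.
Hypothesis N2 : num_order G 2 = 2 * a - 1.
Hypothesis Nn : forall n, 2 < n -> 0 < num_order G n -> num_order G n = a.
Let N := num_order G.

(** The solutions of [x ^ p = 1] number [1 + a], a multiple of [p], so [p] is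
    prime to [a]; those of [x ^ (2p) = 1] number [3a] or [4a], the second when
    some element has order [2p].  Only [p = 3] without elements of order [6] is compatible with
    divisibility by [p]. *)
Lemma odd_prime_eq3 p : prime p -> odd p -> p %| #|G| ->
  [/\ p = 3, 3 %| a.+1 & N 6 = 0].
Proof.
move=> pp op pG.
have p2 : 2 < p by apply: odd_prime_gt2.
have Np : N p = a by apply: Nn => //; apply: num_order_prime_gt0.
have N1 : N 1 = 1 by apply: num_order1.
have pa : p %| a.+1.
  have := @dvdn_sum_num_order G p [:: 1; p] _ _ pG.
  rewrite !big_cons big_nil -/N N1 Np addn0 add1n; apply.
    by rewrite /= inE andbT neq_ltn prime_gt1.
  by move=> m; rewrite !inE; apply/esym; case/primeP: pp => _ h;
    apply/idP/idP => [/h //|/orP[/eqP->|/eqP->]]; rewrite ?dvd1n ?dvdnn.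
have cop : coprime p a.
  by rewrite prime_coprime //; apply/negP => pa'; move: pa;
    rewrite -addn1 dvdn_addr // dvdn1 => /eqP p1; rewrite p1 in p2.
have G2 : 2 %| #|G| by apply: num_order_gt0_dvd; rewrite N2; lia.
have c2p : coprime 2 p by rewrite coprime2n.
have := @dvdn_sum_num_order G (2 * p) [:: 1; 2; p; 2 * p] _ _ _.
rewrite !big_cons big_nil -/N N1 Np addn0 [N 2]N2.
have -> : 1 + (2 * a - 1 + (a + N (2 * p))) = 3 * a + N (2 * p) by lia.
move=> /(_ _ _ _)/(dvdn_trans (dvdn_mull 2 (dvdnn p))) H.
have {}H : p %| 3 * a + N (2 * p).
  apply: H; last by rewrite Gauss_dvd // G2.
    by rewrite /= !inE; lia.
  move=> m; rewrite !inE; apply/idP/idP => [/or4P[]/eqP->|md].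
  - by rewrite dvd1n.
  - by rewrite dvdn_mulr.
  - by rewrite dvdn_mull.
  - by [].
  have [/dvdnP[k mE]|npm] := boolP (p %| m).
    rewrite mE dvdn_pmul2r in md; last by lia.
    have k2 : k <= 2 by apply: dvdn_leq.
    by case: k md k2 mE => [|[|[|k]]] // _ _ ->; rewrite ?mul1n eqxx ?orbT.
  rewrite Gauss_dvdl in md; last by rewrite coprime_sym prime_coprime.
  have m2 : m <= 2 by apply: dvdn_leq.
  by case: m md m2 {npm} => [|[|[|m]]].
have [N0|Npos] := posnP (N (2 * p)).
  move: H; rewrite N0 addn0 Gauss_dvdl // dvdn_prime2 // => /eqP p3.
  by rewrite p3 in pa N0.
have NE : N (2 * p) = a by apply: Nn => //; lia.
move: H; rewrite NE (_ : 3 * a + a = 2 ^ 2 * a) 1?Gauss_dvdl //; last by lia.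
by rewrite Euclid_dvdX //= andbT dvdn_prime2 // => /eqP p2'; rewrite p2' in op.
Qed.

Hypothesis not2G : ~ 2.-group G.

(** By [odd_prime_eq3] only the primes [2] and [3] divide orders, so an order
    above [3] has a divisor among [4], [6] and [9], and each of these three is
    excluded by Frobenius' theorem.  The formula for [#|G|] then adds up the
    elements of orders [1], [2] and [3]. *)
Lemma card_orders_le3 :
  [/\ #|G| = 3 * a, 3 %| a.+1 & {in G, forall x, #[x] <= 3}].
Proof.
have [p /and3P[pp op pG]] : exists p, [&& prime p, odd p & p %| #|G|].
  have : ~~ 2.-group G by apply/negP.
  rewrite -[2.-group G]/(2.-nat #|G|) /pnat cardG_gt0 /= -has_predC.
  case/hasP => p; rewrite mem_primes cardG_gt0 /= => /andP[pp pG] p2.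
  by exists p; rewrite pp pG; case: (even_prime pp) p2 => [->|->].
have [p3 da N6] := odd_prime_eq3 pp op pG; rewrite {}p3 {p pp op} in pG.
have nda : ~~ (3 %| a) by lia.
have N1 : N 1 = 1 by apply: num_order1.
have N3 : N 3 = a by apply: Nn => //; apply: num_order_prime_gt0.
(* [x ^ 9 = 1] would have [1 + 2a] solutions, but [3 | a + 1]. *)
have N9 : N 9 = 0.
  apply/eqP; rewrite -leqn0 leqNgt; apply: contraNN nda => N9.
  have := @dvdn_sum_num_order G 9 [:: 1; 3; 9] isT _ (num_order_gt0_dvd N9).
  rewrite !big_cons big_nil -/N N1 N3 [N 9]Nn // => H.
  have : 9 %| 1 + (a + (a + 0)) by apply: H => m; rewrite [RHS]inE dvdn_divisors.
  by move=> ?; lia.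
(* [x ^ 12 = 1] would have [4a] solutions, with [a] prime to [3]. *)
have N4 : N 4 = 0.
  apply/eqP; rewrite -leqn0 leqNgt; apply: contraNN nda => N4.
  have N12 : N 12 = 0.
    apply/eqP; rewrite -leqn0 leqNgt; apply/negP => N12.
    by have := num_order_dvd_gt0 N12 (isT : 6 %| 12); rewrite -/N N6.
  have G12 : 12 %| #|G| by rewrite (@Gauss_dvd 3 4) // pG num_order_gt0_dvd.
  have := @dvdn_sum_num_order G 12 [:: 1; 2; 3; 4; 6; 12] isT _ G12.
  rewrite !big_cons big_nil -/N N1 [N 2]N2 N3 N6 N12 [N 4]Nn // => H.
  have : 12 %| 1 + (2 * a - 1 + (a + (a + 0))).
    by apply: H => m; rewrite [RHS]inE dvdn_divisors.
  by move=> ?; lia.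
have le3 : {in G, forall x, #[x] <= 3}.
  move=> x Gx.
  have Npos m : m %| #[x] -> 0 < N m.
    by apply: num_order_dvd_gt0; apply/num_order_gt0P; exists x.
  have pr q : prime q -> q %| #[x] -> (q == 2) || (q == 3).
    move=> pq qx; have [->//|oq] := even_prime pq.
    have [-> //] := odd_prime_eq3 pq oq (dvdn_trans qx (order_dvdG Gx)).
  rewrite leqNgt; apply/negP => x4.
  (* A prime divisor of [#[x]] leaves a cofactor above [1], hence a second one. *)
  have two q k : #[x] = q * k -> 1 < q < 4 ->
      exists2 q', (q' == 2) || (q' == 3) & q' * q %| #[x].
    move=> xE q4; have k1 : 1 < k by nia.
    have [q' pq' /dvdnP[l kE]] := pdivP k1.
    exists q'; last by rewrite xE kE mulnC; apply/dvdnP; exists l; lia.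
    by apply: pr => //; rewrite xE kE; apply/dvdnP; exists (q * l); lia.
  have [q pq /dvdnP[k xE]] := pdivP (ltnW (ltnW x4)).
  have qx : q %| #[x] by rewrite xE dvdn_mull.
  have [| |q' q'E /Npos] := two q k; first by rewrite mulnC.
    by case/orP: (pr q pq qx) => /eqP->.
  by case/orP: (pr q pq qx) => /eqP->; case/orP: q'E => /eqP->;
    rewrite ?N4 ?N6 ?N9.
split=> //.
have := @sum_num_order G [:: 1; 2; 3] isT.
rewrite !big_cons big_nil -/N N1 [N 2]N2 N3 => sE.
transitivity (1 + (2 * a - 1 + (a + 0))); last by lia.
rewrite -sE; apply: eq_card => x; rewrite !inE.
have [Gx|//] := boolP (x \in G).
by move: (le3 x Gx) (order_gt0 x); case: #[x] => [|[|[|[|]]]].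
Qed.

End ConstantCounts.

(** * Groups of order [3a] whose elements have order at most [3] *)

Lemma two_group_le3_abelian P :
  2.-group P -> {in P, forall x, #[x] <= 3} -> abelian P.
Proof.
move=> twoP le3; suff: 2.-abelem P by case/and3P.
apply: exponent2_abelem; apply/exponentP => x Px; apply/eqP.
rewrite -order_dvdn.
have : 2.-nat #[x] by apply: mem_p_elt Px.
by move: (le3 x Px) (order_gt0 x); case: #[x] => [|[|[|[|]]]].
Qed.

Section OrdersLe3.

Variables (G : {group gT}) (a : nat).
Hypothesis oG : #|G| = 3 * a.
Hypothesis a3 : 3 %| a.+1.
Hypothesis le3 : {in G, forall x, #[x] <= 3}.

Lemma card_Sylow2_eq P : 2.-Sylow(G) P -> #|P| = a.
Proof.
move=> sylP; rewrite (card_Hall sylP) oG.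
have a0 : 0 < a by have := cardG_gt0 G; rewrite oG; lia.
rewrite partnM // part_p'nat // mul1n part_pnat_id //.
apply/pnatP => // q pq qa.
have [|x Gx ox] := @Cauchy _ q G pq; first by rewrite oG dvdn_mull.
have := le3 Gx; rewrite ox.
by case: q pq qa {ox} => [|[|[|[|]]]] // _ ? _; lia.
Qed.

(** The centraliser is a [2]-group, since an element of order [3] commuting with
    the involution [u] would produce one of order [6]; and it contains [P], which
    is abelian.  Maximality of [P] among [2]-subgroups gives equality. *)
Lemma cent1_Sylow2 P u : 2.-Sylow(G) P -> u \in P -> u != 1%g -> 'C_G[u] = P.
Proof.
move=> sylP Pu u1; have [sPG twoP _] := and3P sylP.
have cPP : abelian P.
  by apply: two_group_le3_abelian => // x Px; apply: le3; apply: (subsetP sPG).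
have ou : #[u] = 2.
  have : 2.-nat #[u] by apply: mem_p_elt Pu.
  move: u1 (le3 (subsetP sPG u Pu)) (order_gt0 u); rewrite -order_eq1.
  by case: #[u] => [|[|[|[|]]]].
apply: (sub_pHall sylP); last 2 first.
- by rewrite subsetI sPG sub_cent1 (subsetP cPP).
- exact: subsetIl.
apply/pgroupP => q pq /(Cauchy pq)[x /setIP[Gx /cent1P cux] ox].
have q3 : q <= 3 by rewrite -ox le3.
case: q pq ox q3 => [|[|[|[|]]]] // _ ox _.
have : #[u * x] <= 3 by rewrite le3 // groupM // (subsetP sPG).
by rewrite orderM ?ou ?ox.
Qed.

(** As [P] has only [a - 1] nontrivial elements, some involution lies in another
    Sylow [2]-subgroup [Q].  A nontrivial common element would have both [P] and
    [Q] as centraliser, so [P * Q] has [a * a] elements inside a group of order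
    [3a]. *)
Lemma Sylow2_le3 P : 2.-Sylow(G) P -> a <= num_order G 2 -> a <= 3.
Proof.
move=> sylP aN; have [sPG twoP _] := and3P sylP.
have oP := card_Sylow2_eq sylP.
have /subsetPn[t] : ~~ ([set x in G | #[x] == 2] \subset P).
  apply/negP => sIP.
  have : [set x in G | #[x] == 2] \subset P :\ 1%g.
    by rewrite subsetD1 sIP inE order1 andbF.
  move/subset_leq_card; rewrite leqNgt => /negP[].
  by move: aN; rewrite -oP (cardsD1 1%g P) group1.
rewrite inE => /andP[Gt /eqP ot] nPt.
have [||Q sylQ] := @Sylow_superset 2 _ G <[t]>%G.
- by rewrite cycle_subG.
- by rewrite /pgroup -orderE ot.
rewrite cycle_subG => Qt.
have tiPQ : P :&: Q = 1%g.
  apply/eqP; rewrite -subG1; apply/subsetP => u /setIP[Pu Qu].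
  rewrite inE; apply: contraR nPt => u1.
  by rewrite -(cent1_Sylow2 sylP Pu u1) (cent1_Sylow2 sylQ Qu u1).
have := subset_leq_card (mul_subG sPG (pHall_sub sylQ)).
by rewrite TI_cardMg // oP (card_Sylow2_eq sylQ) oG; nia.
Qed.

End OrdersLe3.

(** * Groups of order [6] *)

(** Two involutions generate a subgroup of even order above [2] dividing [6],
    hence the whole group, and two involutions generate a dihedral group. *)
Lemma two_involutions_isog_D6 G x y : #|G| = 6 -> x \in G -> y \in G ->
  #[x] = 2 -> #[y] = 2 -> x != y -> G \isog 'D_6.
Proof.
move=> oG Gx Gy ox oy xy.
have sHG : <<[set x; y]>> \subset G.
  by rewrite gen_subG; apply/subsetP => z; rewrite !inE => /orP[]/eqP->.
have oH : #|<<[set x; y]>>| = 6.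
  have d6 : #|<<[set x; y]>>| %| 6 by rewrite -oG cardSg.
  have d2 : 2 %| #|<<[set x; y]>>|.
    by rewrite -ox order_dvdG // mem_gen // !inE eqxx.
  have : 2 < #|<<[set x; y]>>|.
    have : [set 1%g; x; y] \subset <<[set x; y]>>.
      apply/subsetP => z; rewrite !inE => /orP[/orP[]|]/eqP->;
        rewrite ?group1 //;
      by rewrite mem_gen // !inE eqxx ?orbT.
    move/subset_leq_card; rewrite -setUA cardsU1 cards2 xy !inE negb_or.
    by rewrite ![1%g == _]eq_sym -!order_eq1 ox oy.
  have l6 : #|<<[set x; y]>>| <= 6 by apply: dvdn_leq.
  by move: d2 l6 d6; case: #|_| => [|[|[|[|[|[|[|]]]]]]].
have <- : <<[set x; y]>> = G by apply/eqP; rewrite eqEcard sHG oH oG.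
by have := involutions_gen_dihedral ox oy xy; rewrite /= oH.
Qed.

End OrderCounts.

Section ThreeSizes.

Set Implicit Arguments.
Unset Strict Implicit.
Unset Printing Implicit Defensive.

Local Open Scope group_scope.
Local Open Scope nat_scope.

Lemma S3_isog_D6 : [set: 'S_3] \isog 'D_6.
Proof.
have o2 (i : 'I_3) : i != ord0 -> #[tperm ord0 i] = 2.
  move=> i0; apply/eqP; rewrite eqn_leq dvdn_leq //=.
    rewrite ltn_neqAle order_gt0 andbT eq_sym order_eq1.
    by apply: contra i0 => /eqP/permP/(_ ord0); rewrite tpermL perm1 => ->.
  by rewrite order_dvdn expgS expg1 tperm2.
apply: (@two_involutions_isog_D6 _ _ (tperm ord0 (inord 1))
                                     (tperm ord0 (inord 2)));
  rewrite ?inE ?o2 //.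
- by rewrite cardsT card_Sn.
- by rewrite -val_eqE /= inordK.
- by rewrite -val_eqE /= inordK.
apply/eqP => /permP/(_ ord0); rewrite !tpermL => /(congr1 val).
by rewrite /= !inordK.
Qed.

(** * Three-element same-order types *)

Lemma sort_fset3 (A : {fset nat}) : #|` A|%fset = 3 -> exists u v w,
  [/\ sort leq (enum_fset A) = [:: u; v; w], u < v < w &
      forall n, (n \in A) = [|| n == u, n == v | n == w]].
Proof.
move=> A3; have : sorted ltn (sort leq (enum_fset A)).
  by rewrite ltn_sorted_uniq_leq sort_uniq fset_uniq (sort_sorted leq_total).
have : size (sort leq (enum_fset A)) = 3 by rewrite size_sort.
have := mem_sort leq (enum_fset A).
case: (sort _ _) => [|u [|v [|w [|]]]] // memA _ /= /and3P[uv vw _].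
by exists u, v, w; rewrite uv vw; split=> // n; rewrite -[LHS]memA !inE.
Qed.

Lemma num_cyclic2_gt1 (gT : finGroupType) (G : {group gT}) :
  1 < num_order G 2 -> 1 < num_cyclic_subgroups 2 G.
Proof.
case/card_gt1P => x [y [Ix Iy xy]].
have [Gx ox Gy oy] : [/\ x \in G, #[x] = 2, y \in G & #[y] = 2].
  by move: Ix Iy; rewrite !inE => /andP[-> /eqP->] /andP[-> /eqP->].
apply/card_gt1P; exists <[x]>%G, <[y]>%G; split.
- by rewrite !inE cycle_subG Gx cycle_cyclic -orderE ox.
- by rewrite !inE cycle_subG Gy cycle_cyclic -orderE oy.
apply: contra xy => /eqP/(congr1 (@gval _)) /= xyE.
have : x \in <[y]> by rewrite -xyE cycle_id.
by rewrite (cycle2g oy) !inE -order_eq1 ox.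
Qed.

End ThreeSizes.

Theorem theorem2p3 (gT : finGroupType) (G : {group gT})
    (htau : #|` tau_e G|%fset = 3)
    (hG : ~ ((2.-group G)%g /\ 1 < num_cyclic_subgroups 2 G)) :
  arithmetic_progression (tau_e G) <-> (G \isog [set: 'S_3])%g.
Proof.
have [u [v [w [sortE /andP[uv vw] tauE]]]] := sort_fset3 htau.
have tauP n : 0 < num_order G n -> (num_order G n) \in tau_e G.
  by move=> /num_order_gt0P[x Gx ox]; apply/mem_tau_e; exists x; rewrite ?ox.
have tauN n : n \in tau_e G -> exists2 m, num_order G m = n & 0 < num_order G m.
  move/mem_tau_e => [x Gx ->]; exists #[x]%g => //.
  by apply/num_order_gt0P; exists x.
have [k1 k1E k10] : exists2 m, num_order G m = u & 0 < num_order G m.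
  by apply: tauN; rewrite tauE eqxx.
have u1 : u = 1.
  have : 1 \in tau_e G by rewrite -(num_order1 G) tauP // num_order1.
  by rewrite tauE; lia.
have [kv kvE kv0] : exists2 m, num_order G m = v & 0 < num_order G m.
  by apply: tauN; rewrite tauE eqxx orbT.
have [kw kwE kw0] : exists2 m, num_order G m = w & 0 < num_order G m.
  by apply: tauN; rewrite tauE eqxx !orbT.
rewrite {}u1 {k1 k1E k10 u} in sortE uv tauE *.
split=> [[r]|isoG].
  rewrite sortE /= => /and3P[/eqP vE /eqP wE _].
  (* The largest size is odd, so it is not attained at an order above [2]. *)
  have N2 : num_order G 2 = 2 * v - 1.
    have : ~~ (2 < kw).
      by apply/negP => /(@num_order_even _ G); rewrite kwE; lia.
    case: kw kwE kw0 => [|[|[|//]]]; last by lia.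
      by move=> _ /num_order_gt0P[x _]; case: #[x]%g (order_gt0 x).
    by rewrite num_order1; lia.
  have Nn n : 2 < n -> 0 < num_order G n -> num_order G n = v.
    by move=> n2 /tauP; rewrite tauE; have := @num_order_even _ G n n2; lia.
  have not2G : ~ (2.-group G)%g.
    by move=> G2; apply: hG; split=> //; apply: num_cyclic2_gt1; lia.
  have [oG v3 le3] := card_orders_le3 uv N2 Nn not2G.
  have [P sylP] := Sylow_exists 2 G.
  have {}v3 : v = 2 by have := Sylow2_le3 oG v3 le3 sylP; lia.
  rewrite {}v3 in N2 oG.
  have /card_gt1P[x [y [Ix Iy xy]]] : 1 < num_order G 2 by rewrite N2.
  move: Ix Iy; rewrite !inE => /andP[Gx /eqP ox] /andP[Gy /eqP oy].
  have GD := two_involutions_isog_D6 oG Gx Gy ox oy xy.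
  by apply: isog_trans GD _; rewrite isog_sym S3_isog_D6.
have oG : #|G| = 6 by rewrite (card_isog isoG) cardsT card_Sn.
have us : uniq [:: 1; kv; kw].
  have neq m n : num_order G m != num_order G n -> m != n.
    by apply: contraNneq => ->.
  have n1v : 1 != kv by apply: neq; rewrite num_order1 kvE; lia.
  have n1w : 1 != kw by apply: neq; rewrite num_order1 kwE; lia.
  have nvw : kv != kw by apply: neq; rewrite kvE kwE; lia.
  by rewrite /= !inE negb_or n1v n1w nvw.
have := sum_num_order G us.
rewrite !big_cons big_nil kvE kwE num_order1 => sE.
have : #|[set x in G | #[x]%g \in [:: 1; kv; kw]]| <= #|G|.
  by apply/subset_leq_card/subsetP => x; rewrite inE => /andP[].
rewrite {}sE oG => le6; exists 1; rewrite sortE /=; lia.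
Qed.
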